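(* Let $X$ and $Y$ be finitely ramified fractals with undistorted metrics. Then any piecewise cellular homeomorphism from $X$ to $Y$ is a quasisymmetry.
   Context: A finitely ramified cell structure on a compact, connected, metrizable space $X$ consists of a locally finite rooted tree of subsets of $X$, called cells, such that: (1) every cell is compact, connected, and has nonempty interior; (2) the root is the whole space $X$, and each cell is the union of its children; (3) the intersection of any two distinct cells at the same level is a finite set; (4) for every infinite descending path $X=E_0\supseteq E_1\supseteq\cdots$ in the tree, $\bigcap_n E_n$ is a single point. Cells at level $n$ are called $n$-cells (the root being at level $0$). The same subset may occur at several levels; formally a cell is a pair $(E,n)$. A finitely ramified fractal is a metrizable space with a finitely ramified cell structure. Metrics on $X$ are understood to induce the topology of $X$. A metric $d$ on $X$ is undistorted if: (Exponential Decay) there are constants $0<r\le R<1$ and $C\ge1$ such that $\frac{r^{n-m}}{C}\le\frac{\operatorname{diam}(E')}{\operatorname{diam}(E)}\le CR^{n-m}$ for every $m$-cell $E$ and $n$-cell $E'$ with $n\ge m$ and $E\cap E'\neq\emptyset$; and (Cell Separation) there is $\delta>0$ such that $d(E_1,E_2)\ge\delta\operatorname{diam}(E_1)$ for every pair $E_1,E_2$ of disjoint $n$-cells (same $n$), where $d(E_1,E_2)=\inf\{d(x,y):x\in E_1,y\in E_2\}$. A homeomorphism between an $m$-cell $E$ and an $n$-cell $E'$ is cellular if, for each $k\ge0$, it maps $(m+k)$-cells contained in $E$ to $(n+k)$-cells contained in $E'$. A homeomorphism $h\colon X\to Y$ between finitely ramified fractals is piecewise cellular if $X$ and $Y$ can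 be subdivided into finitely many cells $E_1,\ldots,E_k$ and $E_1',\ldots,E_k'$, respectively (that is, the cells cover the space and distinct ones intersect in finite sets), such that $h$ maps each $E_i$ cellularly to $E_i'$. A homeomorphism $h\colon (X,d_X)\to (Y,d_Y)$ between metric spaces is a quasisymmetry if there is a homeomorphism $\eta\colon[0,\infty)\to[0,\infty)$ with $\frac{d_Y(h(a),h(b))}{d_Y(h(a),h(c))}\le \eta\left(\frac{d_X(a,b)}{d_X(a,c)}\right)$ for every triple $a,b,c$ of distinct points of $X$. *)

(* Defs.v *)
From mathcomp Require Import all_boot all_order all_algebra.
From mathcomp Require Import all_classical all_reals all_analysis.
Set Implicit Arguments.
Unset Strict Implicit.
Unset Printing Implicit Defensive.
Import Order.TTheory GRing.Theory Num.Theory.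
Import numFieldNormedType.Exports.
Local Open Scope classical_set_scope.
Local Open Scope ring_scope.

(* A cell is a pair of a level n and a set E with [cells n E], so one set may
   occur at several levels; [children n E] are the (n+1)-cells below (E, n).
   Compactness and connectedness of X come from those of the root.  The library
   counts set0 as connected; [cell_interior] rules it out. *)
Record cell_structure (X : topologicalType) := CellStructure {
  cells : nat -> set (set X) ;
  children : nat -> set X -> set (set X) ;
  children_cells : forall n E F, children n E F -> cells n E /\ cells n.+1 F ;
  cells_parent : forall n F, cells n.+1 F -> exists! E, children n E F ;
  children_finite : forall n E, cells n E -> finite_set (children n E) ;
  cell_compact : forall n E, cells n E -> compact E ;
  cell_connected : forall n E, cells n E -> connected E ;
  cell_interior : forall n E, cells n E -> interior E !=set0 ;
  cells_root : cells 0 = [set [set: X]] ;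
  cell_children : forall n E, cells n E -> E = \bigcup_(F in children n E) F ;
  cells_meet_finite : forall n E F, cells n E -> cells n F -> E <> F ->
    finite_set (E `&` F) ;
  cells_path : forall E : nat -> set X, E 0%N = [set: X] ->
    (forall n, children n (E n) (E n.+1)) ->
    exists x, \bigcap_n E n = [set x]
}.

(* [sup] and [inf] are real-valued and meaningful here only for nonempty sets
   that are bounded above (for [diam]), which cells, being compact, are. *)
Definition diam (R : realType) (X : metricType R) (A : set X) : R :=
  sup [set mdist x y | x in A & y in A].

Definition set_dist (R : realType) (X : metricType R) (A B : set X) : R :=
  inf [set mdist x y | x in A & y in B].

(* The bounds on diam E' / diam E are multiplied out by diam E, which vanishes
   only when X is a single point. *)
Definition exponential_decay (R : realType) (X : metricType R)
    (S : cell_structure X) : Prop :=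
  exists r s C : R, [/\ 0 < r, r <= s, s < 1, 1 <= C &
    forall m n E E', cells S m E -> cells S n E' -> (m <= n)%N ->
      E `&` E' !=set0 ->
      r ^+ (n - m) / C * diam E <= diam E' /\
      diam E' <= C * s ^+ (n - m) * diam E].

Definition cell_separation (R : realType) (X : metricType R)
    (S : cell_structure X) : Prop :=
  exists2 delta : R, 0 < delta &
    forall n E1 E2, cells S n E1 -> cells S n E2 -> E1 `&` E2 = set0 ->
      delta * diam E1 <= set_dist E1 E2.

Definition undistorted (R : realType) (X : metricType R)
    (S : cell_structure X) : Prop :=
  exponential_decay S /\ cell_separation S.

(* f restricts to a homeomorphism of A onto B for the subspace topologies; the
   values of f outside A are irrelevant. *)
Definition homeo_on (X Y : topologicalType) (A : set X) (B : set Y)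
    (f : X -> Y) : Prop :=
  exists g : Y -> X,
    [/\ forall x, A x -> B (f x) /\ g (f x) = x,
        forall y, B y -> A (g y) /\ f (g y) = y,
        {within A, continuous f} & {within B, continuous g}].

Definition homeo (X Y : topologicalType) (f : X -> Y) : Prop :=
  homeo_on [set: X] [set: Y] f.

Definition cellular (X Y : topologicalType)
    (SX : cell_structure X) (SY : cell_structure Y)
    (m : nat) (E : set X) (n : nat) (E' : set Y) (f : X -> Y) : Prop :=
  [/\ cells SX m E, cells SY n E', homeo_on E E' f &
    forall k F, cells SX (m + k) F -> F `<=` E ->
      cells SY (n + k) (f @` F) /\ f @` F `<=` E'].

Definition subdivision (X : topologicalType) (S : cell_structure X) (k : nat)
    (l : 'I_k -> nat) (E : 'I_k -> set X) : Prop :=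
  [/\ forall i, cells S (l i) (E i),
      \bigcup_i E i = [set: X] &
      forall i j, i != j -> finite_set (E i `&` E j)].

Definition piecewise_cellular (X Y : topologicalType)
    (SX : cell_structure X) (SY : cell_structure Y) (h : X -> Y) : Prop :=
  exists (k : nat) (l l' : 'I_k -> nat)
         (E : 'I_k -> set X) (E' : 'I_k -> set Y),
    [/\ subdivision SX l E, subdivision SY l' E' &
        forall i, cellular SX SY (l i) (E i) (l' i) (E' i) h].

Definition quasisymmetry (R : realType) (X Y : metricType R) (h : X -> Y) :
    Prop :=
  homeo h /\
  exists2 eta : R -> R, 
    homeo_on (`[0, +oo[ : set R) (`[0, +oo[ : set R) eta &
    forall a b c : X, a <> b -> b <> c -> a <> c ->
      mdist (h a) (h b) / mdist (h a) (h c) <= eta (mdist a b / mdist a c).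

(* Main.v *)
Require Import Defs.
From mathcomp Require Import all_boot all_order all_algebra.
From mathcomp Require Import all_classical all_reals all_analysis.
From mathcomp Require Import ring lra zify.
Set Implicit Arguments.
Unset Strict Implicit.
Unset Printing Implicit Defensive.
Import Order.TTheory GRing.Theory Num.Theory.
Import numFieldNormedType.Exports.
Local Open Scope classical_set_scope.
Local Open Scope ring_scope.

(* Let N(x, y) be the largest n such that x and y lie in n-cells that meet.  For
   an undistorted metric, d(x, y) is comparable to the diameter of any
   N(x, y)-cell containing x: the triangle inequality bounds it above, and cell
   separation one level further down bounds it below.  Hence d(a, b) / d(a, c) is
   controlled from both sides by exponentials in N(a, b) - N(a, c).  A piecewise
   cellular map changes N by at most a constant, since every sufficiently small
   cell lies in a single piece, so the two ratios are related by powers. *)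

(** * Infinite sets: pigeonhole and intervals *)

Lemma infinite_setI_bigcup (T I : Type) (A : set T) (D : set I)
    (F : I -> set T) :
  infinite_set A -> finite_set D -> A `<=` \bigcup_(i in D) F i ->
  exists2 i, D i & infinite_set (A `&` F i).
Proof.
move=> infA finD sAF; apply: contrapT => nex; apply: infA.
apply: (@sub_finite_set _ _ (\bigcup_(i in D) (A `&` F i))).
  by move=> x Ax; have [i Di Fix] := sAF x Ax; exists i.
apply: bigcup_finite => // i Di; apply: contrapT => inf.
by apply: nex; exists i.
Qed.

Lemma infinite_itvcc (R : realType) (d : R) :
  0 < d -> infinite_set `[0, d]%classic.
Proof.
move=> d0 fin; apply: infinite_nat.
pose f (n : nat) := d / n.+1%:R.
have injf : injective f.
  move=> m n /(mulfI (lt0r_neq0 d0)) /invr_inj /eqP.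
  by rewrite eqr_nat => /eqP[].
rewrite -(eq_finite_set (inj_card_eq (f := f) _)); last first.
  by move=> m n _ _; exact: injf.
apply: sub_finite_set fin => _ [n _ <-] /=; rewrite in_itv /= /f.
apply/andP; split; first by rewrite divr_ge0// ltW.
by rewrite ler_pdivrMr ?ltr0n// ler_peMr ?ler1n// ltW.
Qed.

(** * Cells, their ancestors, and adjacency at a given level *)

Section Combinatorics.
Variables (X : topologicalType) (S : cell_structure X).

Lemma child_sub n E F : children S n E F -> F `<=` E.
Proof.
move=> EF x Fx; have [cE _] := children_cells EF.
by rewrite (cell_children cE); exists F.
Qed.

Lemma cell_ancestor m n F : (m <= n)%N -> cells S n F ->
  exists2 E, cells S m E & F `<=` E.
Proof.
elim: n F => [|n IH] F; first by rewrite leqn0 => /eqP -> cF; exists F.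
rewrite leq_eqVlt => /predU1P[-> cF|]; first by exists F.
rewrite ltnS => mn /cells_parent[G [GF _]].
have [cG _] := children_cells GF.
have [E cE GE] := IH G mn cG; exists E => //.
exact: subset_trans (child_sub GF) GE.
Qed.

Lemma cell_descendant m n E x : (m <= n)%N -> cells S m E -> E x ->
  exists F, [/\ cells S n F, F `<=` E & F x].
Proof.
move=> /subnKC <- cE Ex; elim: (n - m)%N => [|k [F [cF FE Fx]]].
  by rewrite addn0; exists E; split.
move: Fx; rewrite (cell_children cF) => -[G FG Gx].
exists G; rewrite addnS; split=> //; first by case: (children_cells FG).
exact: subset_trans (child_sub FG) FE.
Qed.

Lemma cell_cover n x : exists2 E, cells S n E & E x.
Proof.
have c0 : cells S 0 setT by rewrite cells_root.
have [F [cF _ Fx]] := cell_descendant (leq0n n) c0 (I : setT x).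
by exists F.
Qed.

(** Every cell of level [n.+1] has a parent, so these cells lie in a finite union of finite sets of
    children. *)
Lemma finite_cells n : finite_set (cells S n).
Proof.
elim: n => [|n IH]; first by rewrite cells_root; exact: finite_set1.
apply: (sub_finite_set _ (bigcup_finite IH (@children_finite _ S n))).
by move=> F /cells_parent[E [EF _]]; exists E => //; case: (children_cells EF).
Qed.

Lemma cell_nonempty n E : cells S n E -> E !=set0.
Proof.
by move=> /cell_interior[x Ex]; exists x; exact: interior_subset Ex.
Qed.

(** The finite-intersection axiom read backwards. With the pigeonhole lemma, this is how cells get
    identified below. *)
Lemma cell_eq n E F : cells S n E -> cells S n F ->
  infinite_set (E `&` F) -> E = F.
Proof.
by move=> cE cF inf; apply: contrapT => /(cells_meet_finite cE cF).
Qed.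

Hypothesis inf_cells : forall n E, cells S n E -> infinite_set E.

(* An infinite cell meets some piece of a subdivision in an infinite set, and
   then its ancestor at the level of that piece must be the piece itself. *)
Lemma subdivision_sub k (l : 'I_k -> nat) (E : 'I_k -> set X) n F :
  subdivision S l E -> (forall i, l i <= n)%N -> cells S n F ->
  exists i, F `<=` E i.
Proof.
move=> [cE covE _] ln cF.
have [|i _ infFE] := @infinite_setI_bigcup _ _ F setT E (inf_cells cF)
  (finite_finset).
  by rewrite covE.
have [G cG FG] := cell_ancestor (ln i) cF.
exists i; rewrite -(cell_eq cG (cE i)) //.
by apply: sub_infinite_set infFE; exact: setSI.
Qed.

Definition adjacent_at n x y := exists E F,
  [/\ cells S n E, cells S n F, E x, F y & E `&` F !=set0].

Lemma adjacent0 x y : adjacent_at 0 x y.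
Proof.
by exists setT, setT; rewrite cells_root setIT; split=> //; exists x.
Qed.

Lemma adjacentW m n x y : (m <= n)%N -> adjacent_at n x y -> adjacent_at m x y.
Proof.
move=> mn [E [F [cE cF Ex Fy [z [Ez Fz]]]]].
have [E' cE' EE'] := cell_ancestor mn cE.
have [F' cF' FF'] := cell_ancestor mn cF.
exists E', F'; split=> //; [exact: EE'|exact: FF'|].
by exists z; split; [exact: EE'|exact: FF'].
Qed.

(** The relation [N(x, y) = n]: since adjacency passes to smaller levels, failure at [n.+1] makes
    [n] the largest level of adjacency. No [n] qualifies when [x = y]. *)
Definition separation_level n x y :=
  adjacent_at n x y /\ ~ adjacent_at n.+1 x y.

Lemma separation_level_max m n x y : adjacent_at m x y ->
  separation_level n x y -> (m <= n)%N.
Proof.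
move=> am [_ nan]; rewrite leqNgt; apply/negP => nm.
by apply: nan; exact: adjacentW am.
Qed.

End Combinatorics.

(** * Effect of a piecewise cellular map on adjacency *)

Section PiecewiseCellular.
Variables (X Y : topologicalType) (SX : cell_structure X).
Variables (SY : cell_structure Y) (h : X -> Y).
Hypothesis infX : forall n E, cells SX n E -> infinite_set E.
Hypothesis infY : forall n E, cells SY n E -> infinite_set E.
Hypothesis injh : injective h.
Hypothesis pch : piecewise_cellular SX SY h.

(* The images of the cells of level m + k inside E are finitely many and cover
   F, so one of them meets F in an infinite set and therefore equals F. *)
Lemma cellular_descendant m E n E' k F : cellular SX SY m E n E' h ->
  cells SY (n + k) F -> F `<=` E' ->
  exists2 G, cells SX (m + k) G & h @` G = F.
Proof.
move=> [cE cE' [g [hE gE' _ _]] hcell] cF FE'.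
have [||G [cG GE] inf] := @infinite_setI_bigcup _ _ F
  [set G | cells SX (m + k) G /\ G `<=` E] (fun G => h @` G) (infY cF).
- by apply: sub_finite_set (finite_cells SX (m + k)) => G [].
- move=> y /FE' E'y; have [Egy hgy] := gE' _ E'y.
  have [G [cG GE Ggy]] := cell_descendant (leq_addr k m) cE Egy.
  by exists G => //; exists (g y).
exists G => //; have [chG _] := hcell _ _ cG GE.
by apply: cell_eq chG cF _; rewrite setIC.
Qed.

(** A cell deeper than all pieces lies in one piece, on which [h] shifts levels by a fixed amount.
    Giving up [L] levels absorbs both the required depth and the shift, in either direction. *)
Lemma adjacent_image : exists L, forall n x y,
  (adjacent_at SX (n + L) x y -> adjacent_at SY n (h x) (h y)) /\
  (adjacent_at SY (n + L) (h x) (h y) -> adjacent_at SX n x y).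
Proof.
have [k [l [l' [E [E' [subE subE' cel]]]]]] := pch.
(* The sum bounds every [l i] and [l' i], and hence every difference between them. *)
pose L := (\max_i l i + \max_i l' i)%N.
have lL i : (l i <= L)%N.
  by rewrite (leq_trans (leq_bigmax i)) ?leq_addr.
have l'L i : (l' i <= L)%N.
  by rewrite (leq_trans (@leq_bigmax _ l' i)) ?leq_addl.
exists L => n x y; split=> -[A [B [cA cB Ax By [z [Az Bz]]]]].
- have im C : cells SX (n + L) C -> exists2 D, cells SY n D & h @` C `<=` D.
    move=> cC; have [i CE] : exists i, C `<=` E i.
      apply: (subdivision_sub infX subE _ cC) => i.
      exact: leq_trans (lL i) (leq_addl _ _).
    have [_ _ _ hcell] := cel i.
    have lin : (l i <= n + L)%N by exact: leq_trans (lL i) (leq_addl _ _).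
    rewrite -(subnKC lin) in cC.
    have [chC _] := hcell _ _ cC CE.
    have nle : (n <= l' i + (n + L - l i))%N by move: (lL i) => ?; lia.
    have [D cD hCD] := cell_ancestor nle chC.
    by exists D.
  have [A' cA' AA'] := im _ cA; have [B' cB' BB'] := im _ cB.
  exists A', B'; split=> //; [exact/AA'/imageP|exact/BB'/imageP|].
  by exists (h z); split; [exact/AA'/imageP|exact/BB'/imageP].
- have pre D : cells SY (n + L) D -> exists C G,
      [/\ cells SX n C, G `<=` C & h @` G = D].
    move=> cD; have [i DE] : exists i, D `<=` E' i.
      apply: (subdivision_sub infY subE' _ cD) => i.
      exact: leq_trans (l'L i) (leq_addl _ _).
    have lin : (l' i <= n + L)%N by exact: leq_trans (l'L i) (leq_addl _ _).
    rewrite -(subnKC lin) in cD.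
    have [G cG hG] := cellular_descendant (cel i) cD DE.
    have nle : (n <= l i + (n + L - l' i))%N by move: (l'L i) => ?; lia.
    have [C cC GC] := cell_ancestor nle cG.
    by exists C, G.
  have [A' [GA [cA' GA' eA]]] := pre _ cA.
  have [B' [GB [cB' GB' eB]]] := pre _ cB.
  move: Ax By Az Bz; rewrite -eA -eB.
  move=> [x' Gx /injh xx] [y' Gy /injh yy] [z1 Gz1 e1] [z2 Gz2 e2].
  have zz : z1 = z2 by apply: injh; rewrite e1 e2.
  exists A', B'; split=> //.
  - by apply: GA'; rewrite -xx.
  - by apply: GB'; rewrite -yy.
  - by exists z1; split; [exact: GA'|apply: GB'; rewrite zz].
Qed.

End PiecewiseCellular.

(** * Distances compared with diameters of cells *)

Section Metric.
Variables (R : realType) (X : metricType R).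

Lemma mdist_continuous (x : X) : continuous (mdist x : X -> R).
Proof.
move=> y; apply/cvgrPdist_lt => e e0; near=> z.
have : ball y e z by near: z; exact: nbhsx_ballx.
rewrite ballEmdist /= => yz; rewrite ltr_norml; apply/andP; split.
  have := metric_triangle x y z; lra.
have := metric_triangle x z y; rewrite (metric_sym z y); lra.
Unshelve. all: by end_near.
Qed.

Lemma compact_mdist_ub (E : set X) : compact E ->
  has_ubound [set mdist x y | x in E & y in E].
Proof.
move=> cE; have [->|/set0P[x0 Ex0]] := eqVneq E set0.
  by exists 0 => _ [x []].
have : compact (mdist x0 @` E).
  apply: continuous_compact => //.
  by apply: continuous_subspaceT; exact: mdist_continuous.
move=> /compact_bounded[M [_ bM]].
(* [bM] applies only to bounds strictly above [M], hence [M + 1]; the two summands are the legs of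
   the triangle inequality through [x0]. *)
exists ((M + 1) + (M + 1)) => _ [x Ex [y Ey <-]].
have ub z : E z -> mdist x0 z <= M + 1.
  move=> Ez; apply: le_trans (ler_norm _) _.
  by apply: (bM (M + 1)); [rewrite ltrDl|exists z].
have := metric_triangle x x0 y; rewrite (metric_sym x x0).
have := ub _ Ex; have := ub _ Ey; lra.
Qed.

Lemma mdist_le_diam (E : set X) x y : compact E -> E x -> E y ->
  mdist x y <= diam E.
Proof.
move=> cE Ex Ey; apply: ub_le_sup; first exact: compact_mdist_ub.
by exists x => //; exists y.
Qed.

Lemma diam_gt0_points (E : set X) : 0 < diam E ->
  exists x y, [/\ E x, E y & x <> y].
Proof.
move=> d0; apply: contrapT => nxy; move: d0.
suff sub : [set mdist x y | x in E & y in E] `<=` [set 0].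
  (* The supremum of the empty set is 0 by convention, so both cases contradict a positive
     diameter. *)
  have [e|e] := subset_set1 sub; rewrite /diam e ?sup0 ?sup1 ltxx//.
move=> _ [x Ex [y Ey <-]] /=.
have -> : x = y by apply: contrapT => xy; apply: nxy; exists x, y.
exact: mdistxx.
Qed.

(** The distance from [x] maps [E] onto a connected set of reals containing 0 and [mdist x y], hence
    the whole interval between them. *)
Lemma connected_infinite (E : set X) x y : connected E -> E x -> E y ->
  x <> y -> infinite_set E.
Proof.
move=> cE Ex Ey /eqP xy fE.
have d0 : 0 < mdist x y by rewrite mdist_gt0.
apply: (infinite_itvcc d0); apply: sub_finite_set (finite_image (mdist x) fE).
have /connected_intervalP itv : connected (mdist x @` E).
  apply: connected_continuous_connected => //.
  by apply: continuous_subspaceT; exact: mdist_continuous.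
move=> t /=; rewrite in_itv /= => t01.
have E0 : (mdist x @` E) 0 by exists x => //; exact: mdistxx.
have Ed : (mdist x @` E) (mdist x y) by exists y.
exact: (itv _ _ E0 Ed).
Qed.

Lemma set_dist_le (A B : set X) x y : A x -> B y -> set_dist A B <= mdist x y.
Proof.
move=> Ax By; apply: ge_inf; last by exists x => //; exists y.
by exists 0 => _ [a _ [b _ <-]]; exact: mdist_ge0.
Qed.

Variable S : cell_structure X.

(** Exponential decay from the root bounds [diam E] below by a positive multiple of the diameter of
    the space. *)
Lemma cell_diam_gt0 (x0 y0 : X) n E : exponential_decay S -> x0 <> y0 ->
  cells S n E -> 0 < diam E.
Proof.
move=> [r [s [C [r0 rs s1 C1 dec]]]] /eqP x0y0 cE.
have c0 : cells S 0 setT by rewrite cells_root.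
have [x Ex] := cell_nonempty cE.
have [|+ _] := dec 0%N n setT E c0 cE (leq0n n); first by exists x.
apply: lt_le_trans; rewrite mulr_gt0 ?divr_gt0 ?exprn_gt0//.
  exact: lt_le_trans C1.
apply: (@lt_le_trans _ _ (mdist x0 y0)); first by rewrite mdist_gt0.
by apply: mdist_le_diam => //; exact: cell_compact c0.
Qed.

Lemma infinite_cell (x0 y0 : X) n E : exponential_decay S -> x0 <> y0 ->
  cells S n E -> infinite_set E.
Proof.
move=> dec x0y0 cE.
have [x [y [Ex Ey xy]]] := diam_gt0_points (cell_diam_gt0 dec x0y0 cE).
exact: connected_infinite (cell_connected cE) Ex Ey xy.
Qed.

Lemma adjacent_mdist : exponential_decay S -> exists2 K : R, 1 <= K &
  forall n x y E, adjacent_at S n x y -> cells S n E -> E x ->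
  mdist x y <= K * diam E.
Proof.
(* Decay between meeting cells of equal level costs a factor [C]. The chain [E], [F], [G] gives [C]
   for [diam F] and [C * C] for [diam G]. *)
move=> [r [s [C [r0 rs s1 C1 dec]]]]; exists (C + C * C).
  by rewrite -[leLHS]addr0 lerD// mulr_ge0// (le_trans _ C1).
move=> n x y E [F [G [cF cG Fx Gy [z [Fz Gz]]]]] cE Ex.
have [|_] := dec n n E F cE cF (leqnn n); first by exists x.
have [|_] := dec n n F G cF cG (leqnn n); first by exists z.
rewrite subnn expr0 mulr1 => dG dF.
have := mdist_le_diam (cell_compact cF) Fx Fz.
have := mdist_le_diam (cell_compact cG) Gz Gy.
have := metric_triangle x z y.
have : C * diam F <= C * (C * diam E) by rewrite ler_wpM2l// (le_trans _ C1).
lra.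
Qed.

Lemma nonadjacent_mdist : undistorted S -> exists2 K : R, 1 <= K &
  forall n x y E, ~ adjacent_at S n.+1 x y -> cells S n E -> E x ->
  diam E <= K * mdist x y.
Proof.
move=> [[r [s [C [r0 rs s1 C1 dec]]]] [d d0 sep]].
(* Separation of disjoint cells at level [n.+1] costs [1 / d], and descending one level from [E]
   costs [C / r]. The maximum only ensures that the constant is at least 1. *)
exists (Num.max 1 (C / r / d)); first by rewrite le_max lexx.
move=> n x y E nadj cE Ex.
have [F cF Fx] := cell_cover S n.+1 x.
have [G cG Gy] := cell_cover S n.+1 y.
have FG : F `&` G = set0.
  by apply/eqP/negPn/negP => /set0P FG; apply: nadj; exists F, G.
have := le_trans (sep _ _ _ cF cG FG) (set_dist_le Fx Gy).
have [|+ _] := dec n n.+1 E F cE cF (leqnSn n); first by exists x.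
rewrite subSnn expr1 => EF dF.
have C0 : 0 < C by exact: lt_le_trans C1.
apply: (@le_trans _ _ (C / r / d * mdist x y)); last first.
  by rewrite ler_wpM2r ?mdist_ge0// le_max lexx orbT.
rewrite -mulrA [_ / r]mulrC -mulrA ler_pdivlMl// -ler_pdivrMl// mulrA.
rewrite [C^-1 * r]mulrC.
by rewrite ler_pdivlMl// (le_trans _ dF)// ler_pM2l.
Qed.

Lemma separation_level_exists x y : exponential_decay S -> x <> y ->
  exists n, separation_level S n x y.
Proof.
move=> edec xy; have /eqP xy' := xy.
have [K K1 adjK] := adjacent_mdist edec.
have [r [s [C [r0 rs s1 C1 dec]]]] := edec.
(* Adjacency at level [N] forces [mdist x y <= K * C * D * s ^+ N], which fails for large [N]. *)
have [N HN] : exists N, ~ adjacent_at S N x y.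
  have c0 : cells S 0 setT by rewrite cells_root.
  have D0 := cell_diam_gt0 edec xy c0.
  set D := diam setT in D0.
  have s0 : 0 < s by exact: lt_le_trans rs.
  have M0 : 0 < K * C * D by rewrite !mulr_gt0// (lt_le_trans ltr01).
  have [N sN] : exists N, K * C * D * s ^+ N < mdist x y.
    have e0 : 0 < mdist x y / (K * C * D) by rewrite divr_gt0// mdist_gt0.
    have /cvgrPdist_lt/(_ _ e0)[N _ /(_ N (leqnn _))] :
        s ^+ n @[n --> \oo] --> 0.
      by apply: cvg_expr; rewrite gtr0_norm.
    rewrite sub0r normrN gtr0_norm ?exprn_gt0// ltr_pdivlMr// mulrC => ?.
    by exists N.
  exists N => adj; have [E cE Ex] := cell_cover S N x.
  have := adjK _ _ _ _ adj cE Ex.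
  have [|_] := dec 0%N N setT E c0 cE (leq0n N); first by exists x.
  rewrite subn0 -/D => dE dxy; move: sN; apply/negP; rewrite -leNgt.
  apply: (le_trans dxy); rewrite -!mulrA ler_pM2l ?(lt_le_trans ltr01)//.
  by rewrite (mulrC D) mulrA.
have exN : exists n, `[< ~ adjacent_at S n x y >] by exists N; exact/asboolP.
(* The least level of failure is not 0, as the root contains both points; its predecessor is the
   separation level. *)
case: (ex_minnP exN) => -[|n] /asboolP nadj minn.
  by have := adjacent0 S x y.
exists n; split=> //; apply: contrapT => /asboolP /minn.
by rewrite ltnn.
Qed.

Lemma mdist_ratio : undistorted S -> exists r s K : R,
  [/\ 0 < r, r <= s, s < 1, 1 <= K &
   forall a b c i j, separation_level S i a b -> separation_level S j a c ->
     (j <= i)%N ->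
     r ^+ (i - j) * mdist a c <= K * mdist a b /\
     mdist a b <= K * s ^+ (i - j) * mdist a c].
Proof.
move=> und; have [K1 K11 lt1] := adjacent_mdist und.1.
have [K2 K21 lt2] := nonadjacent_mdist und.
have [[r [s [C [r0 rs s1 C1 dec]]]] _] := und.
have K10 : 0 < K1 by exact: lt_le_trans K11.
have K20 : 0 < K2 by exact: lt_le_trans K21.
have C0 : 0 < C by exact: lt_le_trans C1.
(* Each estimate replaces one distance by a diameter ([K1]), passes between the cells [E] and [F],
   which meet at [a] ([C]), and returns to the other distance ([K2]). *)
exists r, s, (K1 * C * K2); split=> //.
  by rewrite -[1]mulr1 ler_pM// -[1]mulr1 ler_pM.
move=> a b c i j [adi nadi] [adj nadj] ji.
have [E cE Ea] := cell_cover S i a.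
have [F cF Fa] := cell_cover S j a.
have [|lo up] := dec j i F E cF cE ji; first by exists a.
have ab1 := lt1 _ _ _ _ adi cE Ea; have ab2 := lt2 _ _ _ _ nadi cE Ea.
have ac1 := lt1 _ _ _ _ adj cF Fa; have ac2 := lt2 _ _ _ _ nadj cF Fa.
have s0 : 0 < s by exact: lt_le_trans rs.
split.
  apply: (@le_trans _ _ (r ^+ (i - j) * (K1 * diam F))).
    by rewrite ler_pM2l// exprn_gt0.
  have -> : r ^+ (i - j) * (K1 * diam F) = K1 * C * (r ^+ (i - j) / C * diam F).
    by field; rewrite gt_eqF.
  rewrite -[K1 * C * K2 * _]mulrA ler_pM2l ?mulr_gt0//.
  exact: le_trans lo ab2.
apply: (le_trans ab1); rewrite -!mulrA ler_pM2l//; apply: (le_trans up).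
by rewrite -mulrA ler_pM2l// mulrCA ler_pM2l// exprn_gt0.
Qed.

End Metric.

(** * Power functions and the control function *)

Section PowerControl.
Variable R : realType.
Implicit Types (p q t y A : R).

Lemma powR_within_continuous p : 0 < p ->
  {within `[0, +oo[, continuous (fun t : R => t `^ p)}.
Proof.
move=> p0; apply/continuous_within_itvcyP; split.
  move=> x; rewrite in_itv /= andbT => x0.
  apply: differentiable_continuous; apply/derivable1_diffP.
  by apply: derivable_powR; rewrite in_itv /= andbT.
by rewrite powR0 ?gt_eqF//; exact: powR_cvg0.
Qed.

(** For [0 < q <= p] this is [A * t]^ q[on the unit interval and]A * t [^ p] beyond it. *)
Definition power_gauge A p q t : R := A * Num.max (t `^ p) (t `^ q).

Lemma powR_max1 p q t : q <= p -> 1 <= t -> Num.max (t `^ p) (t `^ q) = t `^ p.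
Proof. by move=> qp t1; apply/max_idPl; exact: ler_powR. Qed.

Lemma powR_max0 p q t : 0 < q -> q <= p -> 0 <= t <= 1 ->
  Num.max (t `^ p) (t `^ q) = t `^ q.
Proof.
move=> q0 qp /andP[]; rewrite le_eqVlt => /predU1P[<- _|t0 t1].
  by rewrite !powR0 ?gt_eqF ?maxxx// (lt_le_trans q0).
by apply/max_idPr; apply: ger_powR => //; rewrite t0.
Qed.

Lemma powR_min1 p q t : q <= p -> 1 <= t -> Num.min (t `^ p) (t `^ q) = t `^ q.
Proof. by move=> qp t1; apply/min_idPr; exact: ler_powR. Qed.

Lemma powR_min0 p q t : 0 < q -> q <= p -> 0 <= t <= 1 ->
  Num.min (t `^ p) (t `^ q) = t `^ p.
Proof.
move=> q0 qp /andP[]; rewrite le_eqVlt => /predU1P[<- _|t0 t1].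
  by rewrite !powR0 ?gt_eqF ?minxx// (lt_le_trans q0).
by apply/min_idPl; apply: ger_powR => //; rewrite t0.
Qed.

Lemma powRK p t : p != 0 -> 0 <= t -> (t `^ p) `^ p^-1 = t.
Proof. by move=> p0 t0; rewrite -powRrM divff// powRr1. Qed.

Lemma powR_ge1 p t : 0 <= p -> 1 <= t -> 1 <= t `^ p.
Proof. by move=> p0 t1; rewrite -(powRr0 t) ler_powR. Qed.

Lemma powR_le1 p t : 0 <= p -> 0 <= t <= 1 -> t `^ p <= 1.
Proof.
move=> p0 /andP[t0 t1]; rewrite -[leRHS](congr1 (fun f => f p) (powR1 R)).
by apply: ge0_ler_powR => //; rewrite nnegrE.
Qed.

Lemma homeo_on_power_gauge A p q : 0 < A -> 0 < q -> q <= p ->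
  homeo_on (`[0, +oo[ : set R) (`[0, +oo[ : set R) (power_gauge A p q).
Proof.
move=> A0 q0 qp; have p0 : 0 < p by exact: lt_le_trans qp.
have iq0 : 0 < q^-1 by rewrite invr_gt0.
have ip0 : 0 < p^-1 by rewrite invr_gt0.
have ipq : p^-1 <= q^-1 by rewrite lef_pV2.
have pN0 : p != 0 by rewrite gt_eqF.
have qN0 : q != 0 by rewrite gt_eqF.
(* The inverse of a maximum of increasing functions is the minimum of their inverses. The powers of
   [A^-1] are split off so that continuity reduces to that of powers of [y]. *)
pose g y := Num.min (A^-1 `^ q^-1 * y `^ q^-1) (A^-1 `^ p^-1 * y `^ p^-1).
exists g; split.
- move=> t; rewrite /= !in_itv /= !andbT => t0; split.
    by rewrite /power_gauge mulr_ge0 ?(ltW A0)// le_max powR_ge0.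
  rewrite /g /power_gauge -!powRM ?invr_ge0 ?(ltW A0) ?mulr_ge0 ?le_max
    ?powR_ge0 ?(ltW A0)// mulKf ?gt_eqF//.
  have [t1|/ltW t1] := leP t 1.
    rewrite powR_max0 ?t0// powR_min0 ?powRK//.
    by rewrite powR_ge0 powR_le1 ?(ltW q0) ?t0.
  by rewrite powR_max1// powR_min1 ?powRK// powR_ge1 ?(ltW p0).
- move=> y; rewrite /= !in_itv /= !andbT => y0; split.
    by rewrite le_min !mulr_ge0 ?powR_ge0.
  rewrite /g /power_gauge -!powRM ?invr_ge0 ?(ltW A0)//; set t := A^-1 * y.
  have t0 : 0 <= t by rewrite mulr_ge0// invr_ge0 ltW.
  have At : y = A * t by rewrite mulVKf ?gt_eqF.
  rewrite At; congr (_ * _); have [t1|/ltW t1] := leP t 1.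
    rewrite powR_min0 ?t0// powR_max0//; last first.
      by rewrite powR_ge0 powR_le1 ?(ltW iq0) ?t0.
    by rewrite -powRrM mulVf// powRr1.
  rewrite powR_min1// powR_max1 ?powR_ge1 ?(ltW ip0)//.
  by rewrite -powRrM mulVf// powRr1.
- move=> t; apply: cvgM; first exact: cvg_cst.
  apply: (@continuous_max R (subspace (`[0, +oo[ : set R))
    (fun t => t `^ p) (fun t => t `^ q) t); exact: powR_within_continuous.
- move=> t; apply: (@continuous_min R (subspace (`[0, +oo[ : set R))
    (fun y => A^-1 `^ q^-1 * y `^ q^-1) (fun y => A^-1 `^ p^-1 * y `^ p^-1) t);
  apply: cvgM; do ?exact: cvg_cst; exact: powR_within_continuous.
Qed.

End PowerControl.

Lemma powR_ln_ratio (R : realType) (x y : R) : 0 < x < 1 -> 0 < y ->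
  x `^ (ln y / ln x) = y.
Proof.
move=> /andP[x0 x1] y0; have lx : ln x != 0 by rewrite lt_eqF// ln_lt0 ?x0.
by rewrite /powR gt_eqF// divfK// lnK.
Qed.

Lemma powRX (R : realType) (x p : R) n : 0 <= x ->
  (x ^+ n) `^ p = (x `^ p) ^+ n.
Proof.
by move=> x0; rewrite -(powR_mulrn n x0) -(powR_mulrn n (powR_ge0 x p)) powRAC.
Qed.

(** * From level estimates to a power bound *)

Section Gauge.
Variables (R : realType) (r s K r' s' K' : R).
Hypotheses (r0 : 0 < r) (rs : r <= s) (s1 : s < 1) (K1 : 1 <= K).
Hypotheses (r'0 : 0 < r') (r's' : r' <= s') (s'1 : s' < 1) (K'1 : 1 <= K').

(** Here [u], [v] stand for [d(a, b)], [d(a, c)] and [i], [j] for their separation levels; primes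
    denote the images. Powers of the estimates in X become exponentials with the bases of Y, which
    bound [u' / v']. *)
Lemma power_gauge_of_levels L : exists A p q : R,
  [/\ 0 < A, 0 < q, q <= p &
    forall i j i' j' (u v u' v' : R), 0 < u -> 0 < v -> 0 < u' -> 0 < v' ->
    (i <= i' + L)%N -> (i' <= i + L)%N -> (j <= j' + L)%N -> (j' <= j + L)%N ->
    ((j <= i)%N -> r ^+ (i - j) * v <= K * u) ->
    ((i <= j)%N -> v <= K * s ^+ (j - i) * u) ->
    ((j' <= i')%N -> u' <= K' * s' ^+ (i' - j') * v') ->
    ((i' <= j')%N -> r' ^+ (j' - i') * u' <= K' * v') ->
    u' / v' <= power_gauge A p q (u / v)].
Proof.
have s0 : 0 < s by exact: lt_le_trans rs.
have s'0 : 0 < s' by exact: lt_le_trans r's'.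
have r1 : r < 1 by exact: le_lt_trans s1.
have r'1 : r' < 1 by exact: le_lt_trans s'1.
have K0 : 0 < K by exact: lt_le_trans K1.
have K'0 : 0 < K' by exact: lt_le_trans K'1.
(* The exponents are changes of base: [s]^ p = r'[and]r [^ q = s']. The factor [W] pays for the
   change of at most [L + L] in a difference of levels. *)
pose p := ln r' / ln s; pose q := ln s' / ln r; pose W := r' ^+ (L + L).
have sp : s `^ p = r' by rewrite powR_ln_ratio ?s0.
have rq : r `^ q = s' by rewrite powR_ln_ratio ?r0.
have nln x : 0 < x -> x < 1 -> 0 < - ln x.
  by move=> x0 x1; rewrite oppr_gt0 ln_lt0 ?x0.
have pE : p = - ln r' / - ln s by rewrite invrN mulrNN.
have qE : q = - ln s' / - ln r by rewrite invrN mulrNN.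
have q0 : 0 < q by rewrite qE divr_gt0 ?nln.
(* All logarithms are negative; after the sign changes [q] has the smaller numerator and the larger
   denominator. *)
have qp : q <= p.
  rewrite qE pE; apply: ler_pM; rewrite ?invr_ge0; try exact/ltW/nln.
    by rewrite lerN2 ler_ln ?posrE.
  by rewrite lef_pV2 ?posrE ?nln// lerN2 ler_ln ?posrE.
have W0 : 0 < W by rewrite exprn_gt0.
have W1 : W <= 1 by rewrite exprn_ile1 ?ltW.
exists (K' / W * K `^ p), p, q; split=> //.
  by rewrite mulr_gt0 ?divr_gt0 ?powR_gt0.
move=> i j i' j' u v u' v' u0 v0 u'0 v'0 ii' i'i jj' j'j Hr Hs Hs' Hr'.
rewrite /power_gauge; set t := u / v; set t' := u' / v'.
have t0 : 0 < t by rewrite divr_gt0.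
have t'0 : 0 < t' by rewrite divr_gt0.
have Ht' : (j' <= i')%N -> t' <= K' * s' ^+ (i' - j').
  by move=> /Hs'; rewrite ler_pdivrMr.
have Ht'2 : (i' <= j')%N -> r' ^+ (j' - i') * t' <= K'.
  by move=> /Hr'; rewrite mulrA ler_pdivrMr.
have [ij|/ltnW ji] := leqP i j.
  have le1 : 1 <= K `^ p * r' ^+ (j - i) * t `^ p.
    rewrite -sp -powRX ?(ltW s0)// -!powRM//; try exact: ltW.
    - apply: powR_ge1; first exact/ltW/(lt_le_trans q0).
      by rewrite mulrA ler_pdivlMr// mul1r Hs.
    - by rewrite mulr_ge0 ?exprn_ge0 ?ltW.
    - by rewrite exprn_ge0 ?ltW.
  have le2 : r' ^+ (j - i) * t' <= K' / W.
    rewrite ler_pdivlMr//; have [le|/ltnW le] := leqP i' j'.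
      apply: le_trans (Ht'2 le); rewrite mulrAC ler_pM2r// -exprD.
      apply: ler_wiXn2l; [exact: ltW|exact: ltW|].
      by clear -ii' i'i jj' j'j ij le; lia.
    (* When the image levels are in the opposite order, [t' <= K'] already suffices. *)
    apply: (@le_trans _ _ t').
      rewrite mulrAC -exprD ler_piMl ?(ltW t'0)//.
      by rewrite exprn_ile1 ?(ltW r'0) ?(ltW r'1).
    apply: le_trans (Ht' le) _.
    by rewrite ler_piMr ?exprn_ile1 ?(ltW K'0) ?(ltW s'0) ?(ltW s'1).
  apply: (@le_trans _ _ (t' * (K `^ p * r' ^+ (j - i) * t `^ p))).
    by rewrite ler_peMr// ltW.
  apply: (@le_trans _ _ (K' / W * K `^ p * t `^ p)); last first.
    by rewrite ler_pM2l ?le_max ?lexx// mulr_gt0 ?divr_gt0 ?powR_gt0.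
  have -> : t' * (K `^ p * r' ^+ (j - i) * t `^ p) =
    r' ^+ (j - i) * t' * (K `^ p * t `^ p) by ring.
  by rewrite -[leRHS]mulrA ler_pM2r// mulr_gt0// powR_gt0.
have le1 : s' ^+ (i - j) <= K `^ p * t `^ q.
  apply: (@le_trans _ _ (K `^ q * t `^ q)); last first.
    by rewrite ler_pM2r ?powR_gt0// ler_powR.
  rewrite -rq -powRX ?(ltW r0)// -powRM ?(ltW K0) ?(ltW t0)//.
  apply: ge0_ler_powR.
  - exact: ltW.
  - by rewrite nnegrE exprn_ge0 ?ltW.
  - by rewrite nnegrE mulr_ge0 ?ltW.
  by rewrite mulrA ler_pdivlMr// Hr.
have le2 : W * t' <= K' * s' ^+ (i - j).
  have [le|/ltnW le] := leqP j' i'.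
    apply: (@le_trans _ _ (s' ^+ (L + L) * (K' * s' ^+ (i' - j')))).
      apply: ler_pM (Ht' le); rewrite ?exprn_ge0 ?(ltW r'0) ?(ltW t'0)//.
      by apply: lerXn2r; rewrite ?nnegrE ?(ltW r'0) ?(ltW s'0).
    rewrite mulrCA ler_pM2l// -exprD.
    apply: ler_wiXn2l; [exact: ltW|exact: ltW|].
    by clear -ii' i'i jj' j'j ji le; lia.
  (* In the opposite order the two gaps [i - j] and [j' - i'] add up to at most [L + L], so [W] is
     below the product of their powers. *)
  apply: (@le_trans _ _ (r' ^+ (i - j) * (r' ^+ (j' - i') * t'))).
    rewrite mulrA ler_pM2r// -exprD.
    apply: ler_wiXn2l; [exact: ltW|exact: ltW|].
    by clear -ii' i'i jj' j'j ji le; lia.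
  rewrite mulrC; apply: ler_pM (Ht'2 le) _.
  - exact: mulr_ge0 (exprn_ge0 _ (ltW r'0)) (ltW t'0).
  - exact: exprn_ge0 (ltW r'0).
  - by apply: lerXn2r; rewrite ?nnegrE ?(ltW r'0) ?(ltW s'0).
apply: (@le_trans _ _ (K' / W * s' ^+ (i - j))).
  by rewrite mulrAC ler_pdivlMr// mulrC.
rewrite -[leRHS]mulrA ler_pM2l ?divr_gt0//; apply: (le_trans le1).
by rewrite ler_pM2l ?powR_gt0 ?le_max ?lexx ?orbT.
Qed.

End Gauge.

Theorem theorem13 (R : realType) (X Y : metricType R)
  (SX : cell_structure X) (SY : cell_structure Y)
  (undX : undistorted SX) (undY : undistorted SY)
  (h : X -> Y) (hh : homeo h) (hpc : piecewise_cellular SX SY h) :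
  quasisymmetry h.
Proof.
split=> //.
have injh : injective h.
  have [g [hg _ _ _]] := hh; move=> x y hxy.
  by rewrite -(proj2 (hg x I)) hxy (proj2 (hg y I)).
have [r [s [K [r0 rs s1 K1 ratX]]]] := mdist_ratio undX.
have [r' [s' [K' [r'0 r's' s'1 K'1 ratY]]]] := mdist_ratio undY.
have [[x [y xy]]|triv] := pselect (exists x y : X, x <> y); last first.
  (* Without two distinct points there are no triples to control, and any gauge will do. *)
  exists (power_gauge 1 1 1); first by apply: homeo_on_power_gauge.
  by move=> a b c ab; exfalso; apply: triv; exists a, b.
have infX n E : cells SX n E -> infinite_set E.
  exact: infinite_cell undX.1 xy.
have infY n E : cells SY n E -> infinite_set E.
  by apply: infinite_cell undY.1 _ => /injh; exact: xy.
have [L adjL] := adjacent_image infX infY injh hpc.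
have levelL a b i i' : separation_level SX i a b ->
    separation_level SY i' (h a) (h b) -> (i <= i' + L)%N /\ (i' <= i + L)%N.
  (* Adjacency is compared only from levels of the form [l + L]; for [m] below [L] the bound is
     trivial. *)
  have shift m n : (forall l, m = (l + L)%N -> (l <= n)%N) -> (m <= n + L)%N.
    move=> Hm; have [Lm|] := leqP L m; last by lia.
    by rewrite -(subnK Lm) leq_add2r; apply: Hm; rewrite subnK.
  move=> lX lY; split; apply: shift => l e.
    apply: separation_level_max lY; apply: (proj1 (adjL _ _ _)).
    by rewrite -e; exact: lX.1.
  apply: separation_level_max lX; apply: (proj2 (adjL _ _ _)).
  by rewrite -e; exact: lY.1.
have [A [p [q [A0 q0 qp gauge]]]] :=
  power_gauge_of_levels r0 rs s1 K1 r'0 r's' s'1 K'1 L.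
exists (power_gauge A p q); first exact: homeo_on_power_gauge.
move=> a b c ab bc ac.
have hab : h a <> h b by move=> /injh.
have hac : h a <> h c by move=> /injh.
have [i li] := separation_level_exists undX.1 ab.
have [j lj] := separation_level_exists undX.1 ac.
have [i' li'] := separation_level_exists undY.1 hab.
have [j' lj'] := separation_level_exists undY.1 hac.
have [? ?] := levelL _ _ _ _ li li'; have [? ?] := levelL _ _ _ _ lj lj'.
apply: (gauge i j i' j') => //; try by rewrite mdist_gt0; exact/eqP.
(* The ratio estimates require ordered levels, so [b] and [c] exchange roles according to the
   order. *)
- by move=> /(ratX _ _ _ _ _ li lj)[].
- by move=> /(ratX _ _ _ _ _ lj li)[].
- by move=> /(ratY _ _ _ _ _ li' lj')[].
- by move=> /(ratY _ _ _ _ _ lj' li')[].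
Qed.
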